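(* Let $q$ be a prime power and let $u,v\in\mathbb{F}_{q^3}^*$ with $\mathrm{N}_{q^3/q}(-v/u)\neq1$. Let $\mathcal{B}=\{x\in\mathbb{F}_{q^3}:\mathrm{Tr}_{q^3/q}(u^{q^2}v^qx)=u^{q^2+q+1}+v^{q^2+q+1}\}$. Then for every $\beta\in\mathcal{B}$ the equation $ux^{q^2-1}+vx^{q-1}+\beta=0$ has no solution $x\in\mathbb{F}_{q^3}^*$. Moreover, for any $\theta\in\mathcal{B}$ and $a\in\mathbb{F}_{q^3}^*$, letting $L(X)=u^{q^2}v^q\bigl(ua^{q^2-1}X^{q^2}+va^{q-1}X^q+\theta X\bigr)$, the polynomial $\mathrm{Tr}_{q^3/q}(L(X)/X)$ has no root in $\mathbb{F}_{q^3}^*$.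
   Context: $\mathrm{Tr}_{q^3/q}$ and $\mathrm{N}_{q^3/q}$ denote the trace and norm maps from $\mathbb{F}_{q^3}$ to $\mathbb{F}_q$. *)

(* Defs.v *)
From HB Require Import structures.
From mathcomp Require Export all_boot all_order all_algebra all_fingroup.
From mathcomp Require Export all_solvable all_field.

Set Implicit Arguments.
Unset Strict Implicit.
Unset Printing Implicit Defensive.

Import GRing.Theory.
Local Open Scope ring_scope.

Section Defs.

(* [K] plays the role of F_q (so q = #|K|) and [L] that of F_(q^3), once
   [\dim {:L} = 3] is assumed.  Every finite extension of a finite field is
   normal, so asking for a [splittingFieldType] is no restriction (see
   [FinSplittingFieldType]). *)
Variables (K : finFieldType) (L : splittingFieldType K).
Implicit Types (u v a b x : L) (P : {poly L}).

Definition Tr x : L := galTrace 1%AS {:L}%AS x.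
Definition Nm x : L := galNorm 1%AS {:L}%AS x.

Definition in_B (q : nat) u v : pred L := fun x =>
  Tr (u ^+ (q ^ 2) * v ^+ q * x)
    == u ^+ (q ^ 2 + q + 1) + v ^+ (q ^ 2 + q + 1).

Definition Lpoly (q : nat) u v a b : {poly L} :=
  (u ^+ (q ^ 2) * v ^+ q) *:
    ((u * a ^+ (q ^ 2 - 1)) *: 'X^(q ^ 2) + (v * a ^+ (q - 1)) *: 'X^q
     + b *: 'X).

(* Tr applied to a polynomial, P + P^q + P^(q^2); it evaluates to the field
   trace of the value of P, see [horner_Trpoly]. *)
Definition Trpoly (q : nat) P : {poly L} := P + P ^+ q + P ^+ (q ^ 2).

Lemma TrE x : \dim {:L} = 3 -> Tr x = x + x ^+ #|K| + x ^+ (#|K| ^ 2).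
Proof.
move=> dimL.
have sub1 : (1%AS <= {:L}%AS)%VS by apply: sub1v.
have [s gen_s Ds] := finField_galois_generator sub1.
have Dsx y : s y = y ^+ #|K| by rewrite Ds ?memvf //= dimv1 expn1.
have galG := finField_galois sub1.
have cardG := galois_dim galG.
rewrite dimv1 divn1 dimL in cardG.
have DG := eqP gen_s.
have os : #[s]%g = 3 by rewrite /order -DG -cardG.
rewrite /Tr /galTrace DG.
rewrite (eq_bigl [in [set (s ^+ i)%g | i : 'I_3]]); last first.
  move=> y; apply/cycleP/imsetP => [[i ->]|[i _ ->]]; last by exists i.
  exists (inord (i %% 3)) => //.
  by rewrite inordK ?ltn_mod // -(expg_mod_order s i) os.
rewrite big_imset /=; last first.
  move=> i j _ _ /eqP; rewrite eq_expg_mod_order os !modn_small ?ltn_ord //.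
  by move/eqP/val_inj.
rewrite !big_ord_recl big_ord0 addr0 /= /bump /= addrA expg0 expg1.
rewrite gal_id Dsx; congr (_ + _ + _).
by rewrite expgS expg1 galM ?memvf // !Dsx -exprM mulnn.
Qed.

Lemma horner_Trpoly P x :
  \dim {:L} = 3 -> (Trpoly #|K| P).[x] = Tr P.[x].
Proof. by move=> /TrE->; rewrite /Trpoly !hornerE. Qed.

End Defs.

(* Main.v *)
From mathcomp Require Import ring.
Require Import Defs.

(** Write [z'] for [z ^ q]. Expanding the norm of a sum in a cubic extension
    gives [N (a + b) = N a + N b + Tr (a'' b' (a + b))]. For [a = u y'' / y'],
    which has the norm of [u], and [b = v], the last term is
    [Tr (u'' v' (u y^(q^2 - 1) + v y^(q - 1)))]. So when [t] lies in [B],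
    [Tr (u'' v' (u y^(q^2 - 1) + v y^(q - 1) + t))] is the norm of
    [u y'' / y' + v]; it vanishes only if [-v / u = y'' / y'], which has norm 1.
    The first claim is the case where the argument of the trace is zero; in the
    second, [L(x) / x] is this argument at [y = a x]. *)

Set Implicit Arguments.
Unset Strict Implicit.
Unset Printing Implicit Defensive.

Import GRing.Theory.
Local Open Scope ring_scope.

Lemma big_cycle (R : Type) (idx : R) (op : Monoid.com_law idx)
    (gT : finGroupType) (g : gT) (F : gT -> R) :
  \big[op/idx]_(x in <[g]>%g) F x = \big[op/idx]_(i < #[g]%g) F (g ^+ i)%g.
Proof.
have expg_inj : {in 'I_#[g]%g &, injective (fun i : 'I_#[g]%g => g ^+ i)%g}.
  move=> i j _ _ /eqP; rewrite eq_expg_mod_order !modn_small //.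
  by move/eqP/val_inj.
rewrite -(big_imset F expg_inj); apply: eq_bigl => x.
apply/idP/imsetP => [/cyclePmin[i i_lt ->] | [i _ ->]]; last exact: mem_cycle.
by exists (Ordinal i_lt).
Qed.

Section GaloisQuotient.

Variables (F : fieldType) (L : splittingFieldType F) (K E : {subfield L}).
Variable s : gal_of E.
Hypothesis gal_s : s \in 'Gal(E / K)%g.
Implicit Types u v x : L.

Lemma galNorm_gal_div x : x \in E -> x != 0 -> galNorm K E (s x / x) = 1.
Proof.
by move=> Ex x0; rewrite galNormM galNormV galNorm_gal // divff // galNorm_eq0.
Qed.

Lemma galNorm_binomial_neq0 u v x :
  u != 0 -> galNorm K E (- v / u) != 1 -> x \in E -> x != 0 ->
  galNorm K E (u * (s x / x) + v) != 0.
Proof.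
move=> u0 Nvu Ex x0; rewrite galNorm_eq0; apply: contraNneq Nvu => root_x.
by rewrite -(addr0_eq root_x) opprK [_ / u]mulrC mulKf // galNorm_gal_div.
Qed.

End GaloisQuotient.

Section CubicGaloisExtension.

Variables (F : fieldType) (L : splittingFieldType F) (K E : {subfield L}).
Variable s : gal_of E.
Hypotheses (galKE : galois K E) (gen_s : generator 'Gal(E / K) s).
Hypothesis dimKE : \dim_K E = 3%N.
Implicit Types a b u v x y : L.

Let Gal_cycle : 'Gal(E / K)%g = <[s]>%g. Proof. exact/eqP. Qed.

Let order_s : #[s]%g = 3%N.
Proof. by rewrite orderE -Gal_cycle -galois_dim. Qed.

Lemma gal_cubicK x : x \in E -> s (s (s x)) = x.
Proof.
move=> Ex; rewrite -[RHS](@gal_id _ _ E) -(expg_order s) order_s.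
by rewrite !expgS expg0 mulg1 !galM ?memv_gal.
Qed.

Lemma big_gal_cubic (idx : L) (op : Monoid.com_law idx) x :
  x \in E ->
  \big[op/idx]_(t in 'Gal(E / K)%g) t x = op (op x (s x)) (s (s x)).
Proof.
move=> Ex; rewrite Gal_cycle big_cycle order_s !big_ord_recr big_ord0 /=.
by rewrite Monoid.mul1m gal_id expg1 expgS expg1 galM.
Qed.

Lemma galTrace_cubic x : x \in E -> galTrace K E x = x + s x + s (s x).
Proof. exact: big_gal_cubic. Qed.

Lemma galNorm_cubic x : x \in E -> galNorm K E x = x * s x * s (s x).
Proof. exact: big_gal_cubic. Qed.

Lemma galNormD_cubic a b : a \in E -> b \in E ->
  galNorm K E (a + b)
    = galNorm K E a + galNorm K E b + galTrace K E (s (s a) * s b * (a + b)).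
Proof.
move=> Ea Eb; rewrite !galNorm_cubic ?rpredD //.
rewrite galTrace_cubic ?rpredM ?rpredD ?memv_gal //.
by rewrite !(rmorphM, rmorphD) /= !gal_cubicK //; ring.
Qed.

Lemma galNorm_binomial u v y : u \in E -> v \in E -> y \in E -> y != 0 ->
  galNorm K E (u * (s (s y) / s y) + v)
    = galNorm K E u + galNorm K E v
      + galTrace K E (s (s u) * s v * (u * (s (s y) / y) + v * (s y / y))).
Proof.
move=> Eu Ev Ey y0; have sy0 : s y != 0 by rewrite fmorph_eq0.
have gal_s : s \in 'Gal(E / K)%g by rewrite Gal_cycle cycle_id.
rewrite galNormD_cubic ?rpredM ?rpredV ?memv_gal //.
rewrite galNormM (galNorm_gal_div gal_s) ?memv_gal // mulr1.
congr (_ + galTrace K E _).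
by rewrite !rmorphM !fmorphV /= !gal_cubicK ?memv_gal //; field; rewrite y0 sy0.
Qed.

End CubicGaloisExtension.

Section FiniteFieldCubicExtension.

Variables (K : finFieldType) (L : splittingFieldType K).
Hypothesis dimL : \dim {:L} = 3%N.
Local Notation q := #|K|.
Implicit Types u v x y a t : L.

Definition trinomial u v t y : L :=
  u * y ^+ (q ^ 2 - 1) + v * y ^+ (q - 1) + t.

Let q_gt1 : (1 < q)%N. Proof. exact: card_finNzRing_gt1. Qed.

Let q2_gt1 : (1 < q ^ 2)%N.
Proof. by rewrite -(exp1n 2) ltn_exp2r. Qed.

Let gal1L : galois 1%AS {:L}%AS.
Proof. exact: finField_galois (sub1v _). Qed.

Let dim1L : \dim_(1%AS : {subfield L}) {:L}%AS = 3%N.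
Proof. by rewrite dimv1 divn1. Qed.

Lemma Frobenius_generator :
  exists2 s, generator 'Gal({:L} / 1%AS) s & forall x, s x = x ^+ q.
Proof.
have [s gen_s Ds] := finField_galois_generator (sub1v {:L}%AS).
by exists s => // x; rewrite Ds ?memvf //= dimv1 expn1.
Qed.

Lemma NmE x : Nm x = x ^+ (q ^ 2 + q + 1).
Proof.
have [s gen_s Ds] := Frobenius_generator.
rewrite /Nm (galNorm_cubic gal1L gen_s dim1L) ?memvf // !Ds.
by rewrite !exprD -mulnn exprM expr1 mulrC mulrA mulrAC.
Qed.

Lemma Nm_binomial_neq0 u v x :
  u != 0 -> Nm (- v / u) != 1 -> x != 0 -> Nm (u * (x ^+ q / x) + v) != 0.
Proof.
have [s gen_s Ds] := Frobenius_generator; rewrite -Ds => u0 Nvu.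
have gal_s : s \in 'Gal({:L} / 1%AS)%g by rewrite (eqP gen_s) cycle_id.
exact: (galNorm_binomial_neq0 gal_s u0 Nvu (memvf x)).
Qed.

Lemma Tr_trinomial_in_B u v t y : in_B q u v t -> y != 0 ->
  Tr (u ^+ (q ^ 2) * v ^+ q * trinomial u v t y)
    = Nm (u * (y ^+ q ^+ q / y ^+ q) + v).
Proof.
have [s gen_s Ds] := Frobenius_generator.
move=> /eqP; rewrite -!NmE => Bt y0.
rewrite mulrDr [LHS]raddfD addrC [X in X + _]Bt -!Ds.
rewrite [RHS](galNorm_binomial gal1L gen_s dim1L) ?memvf //.
congr (_ + galTrace _ _ _).
by rewrite !Ds -!exprM mulnn !expfB // expr1.
Qed.

Lemma Tr_trinomial_neq0 u v t y :
  u != 0 -> Nm (- v / u) != 1 -> in_B q u v t -> y != 0 ->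
  Tr (u ^+ (q ^ 2) * v ^+ q * trinomial u v t y) != 0.
Proof.
move=> u0 Nvu Bt y0.
by rewrite Tr_trinomial_in_B // Nm_binomial_neq0 // expf_neq0.
Qed.

Lemma Lpoly_divX u v a t :
  Lpoly q u v a t %/ 'X =
    (u ^+ (q ^ 2) * v ^+ q) *:
      ((u * a ^+ (q ^ 2 - 1)) *: 'X^(q ^ 2 - 1)
       + (v * a ^+ (q - 1)) *: 'X^(q - 1) + t%:P).
Proof.
have mulXnX n : (0 < n)%N -> 'X^(n - 1) * 'X = 'X^n :> {poly L}.
  by case: n => // n _; rewrite subn1 -exprSr.
rewrite -[RHS](@mulpK _ _ 'X) ?polyX_eq0 //.
by rewrite -scalerAl !mulrDl -!scalerAl mul_polyC !mulXnX 1?ltnW.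
Qed.

Lemma horner_Lpoly_divX u v a t x :
  (Lpoly q u v a t %/ 'X).[x] =
    u ^+ (q ^ 2) * v ^+ q * trinomial u v t (a * x).
Proof. by rewrite Lpoly_divX /trinomial !hornerE !exprMn !mulrA. Qed.

End FiniteFieldCubicExtension.

Theorem theorem3p7 (p k q : nat) (K : finFieldType) (L : splittingFieldType K)
    (p_prime : prime p) (k_gt0 : (0 < k)%N) (q_pp : q = (p ^ k)%N)
    (card_K : #|K| = q) (dim_L : \dim {:L} = 3%N)
    (u v : L) (u_neq0 : u != 0) (v_neq0 : v != 0)
    (norm_neq1 : Nm (- v / u) != 1) :
  (forall b : L, in_B q u v b ->
     ~ exists x : L,
         x != 0 /\ u * x ^+ (q ^ 2 - 1) + v * x ^+ (q - 1) + b = 0)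
  /\
  (forall t a : L, in_B q u v t -> a != 0 ->
     ~ exists x : L,
         x != 0 /\ root (Trpoly q (Lpoly q u v a t %/ 'X)) x).
Proof.
subst q; rewrite -card_K; split=> [b Bb [x [x0 eq0]] | t a Bt a0 [x [x0]]].
  have := Tr_trinomial_neq0 dim_L u_neq0 norm_neq1 Bb x0.
  by rewrite /trinomial eq0 mulr0 /Tr raddf0 eqxx.
rewrite /root horner_Trpoly // horner_Lpoly_divX; apply/negP.
by apply: Tr_trinomial_neq0 => //; rewrite mulf_neq0.
Qed.
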